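(* Each of the following is an inv-Wilf equivalence class: \begin{align*} &\big\{\{123,132\},\{123,213\}\big\},\\ &\big\{\{231,321\},\{312,321\}\big\},\\ &\big\{\{123,231\},\{123,312\}\big\},\\ &\big\{\{132,321\},\{213,321\}\big\},\\ &\big\{\{132,231\},\{132,312\},\{213,231\},\{213,312\}\big\}. \end{align*} All other inv-Wilf equivalence classes for $\Pi\subset\mathfrak S_3$ with $\#\Pi=2$ and $\Pi\ne\{123,321\}$ consist of a single pair.
   Context: $\mathfrak S_n$ is the set of permutations $\sigma=a_1a_2\ldots a_n$ of $[n]$ in one-line notation. A permutation $\sigma$ avoids $\pi\in\mathfrak S_k$ if no subsequence of $\sigma$ is order isomorphic to $\pi$ (has its entries in the same relative order as $\pi$). For a set $\Pi$ of permutations, $\mathrm{Av}_n(\Pi)$ is the set of $\sigma\in\mathfrak S_n$ avoiding every element of $\Pi$. The inversion number is $\mathrm{inv}\,\sigma=\#\{(i,j): i<j,\ a_i>a_j\}$, and $I_n(\Pi;q)=\sum_{\sigma\in \mathrm{Av}_n(\Pi)}q^{\mathrm{inv}\,\sigma}$. Sets $\Pi,\Pi'$ are inv-Wilf equivalent if $I_n(\Pi;q)=I_n(\Pi';q)$ for all $n\ge0$. Equivalence classes are taken among subsets of $\mathfrak S_3$. *)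

(* Defs.v *)
From HB Require Import structures.
From mathcomp Require Import all_boot all_order all_algebra all_fingroup.

Set Implicit Arguments.
Unset Strict Implicit.
Unset Printing Implicit Defensive.

(* A permutation a_1 ... a_n of [n] is s : 'S_n with a_(i+1) = (s i).+1;      *)
(* the shift by one is immaterial for patterns and inversions.                *)

Definition one_line n (s : 'S_n) : seq nat := [seq (s i).+1 | i <- enum 'I_n].

(* Inverse of one_line; identity if w is not a rearrangement of 1, ..., n+1.  *)
Definition perm_of_word n (w : seq nat) : 'S_n.+1 :=
  insubd (1%g : {perm 'I_n.+1}) [ffun i : 'I_n.+1 => inord (nth 0 w i).-1 : 'I_n.+1].

Lemma perm_of_wordK n (w : seq nat) :
  perm_eq w (iota 1 n.+1) -> one_line (perm_of_word n w) = w.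
Proof.
move=> Hw; have sw : size w = n.+1 by rewrite (perm_size Hw) size_iota.
have uw : uniq w by rewrite (perm_uniq Hw) iota_uniq.
have wP (i : 'I_n.+1) : 0 < nth 0 w i <= n.+1.
  have : nth 0 w i \in iota 1 n.+1 by rewrite -(perm_mem Hw) mem_nth ?sw.
  by rewrite mem_iota add1n ltnS.
have inoE (i : 'I_n.+1) : (inord (nth 0 w i).-1 : 'I_n.+1).+1 = nth 0 w i.
  by have /andP[w0 wn] := wP i; rewrite inordK prednK.
have inj : injectiveb [ffun i : 'I_n.+1 => inord (nth 0 w i).-1 : 'I_n.+1].
  apply/injectiveP => i j; rewrite !ffunE => /(congr1 (fun k : 'I_n.+1 => k.+1)).
  by rewrite !inoE => /eqP; rewrite nth_uniq ?sw // => /eqP/val_inj.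
have sE (i : 'I_n.+1) : (perm_of_word n w i).+1 = nth 0 w i.
  rewrite -inoE; congr (nat_of_ord _).+1.
  by rewrite -pvalE /perm_of_word [pval _]insubdK ?ffunE.
apply: (@eq_from_nth _ 0); first by rewrite size_map size_enum_ord sw.
move=> i; rewrite size_map size_enum_ord => lt_i.
by rewrite (nth_map ord0) ?size_enum_ord // sE nth_enum_ord.
Qed.

Definition contains n k (s : 'S_n) (p : 'S_k) : bool :=
  [exists f : {ffun 'I_k -> 'I_n},
    [forall i : 'I_k, forall j : 'I_k, (i < j) ==> (f i < f j)] &&
    [forall i : 'I_k, forall j : 'I_k, (s (f i) < s (f j)) == (p i < p j)]].

Definition avoids n k (s : 'S_n) (p : 'S_k) : bool := ~~ contains s p.

Definition Av n k (Pi : {set 'S_k}) : {set 'S_n} :=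
  [set s : 'S_n | [forall p in Pi, avoids s p]].

Definition inv n (s : 'S_n) : nat :=
  #|[set ij : 'I_n * 'I_n | (ij.1 < ij.2) && (s ij.2 < s ij.1)]|.

Definition invpoly n k (Pi : {set 'S_k}) : {poly int} :=
  (\sum_(s in Av n Pi) 'X^(inv s))%R.

Definition inv_Wilf_equiv k (Pi Pi' : {set 'S_k}) : Prop :=
  forall n : nat, invpoly n Pi = invpoly n Pi'.

Definition inv_Wilf_class k (C : {set {set 'S_k}}) : Prop :=
  exists Pi : {set 'S_k},
    forall Pi' : {set 'S_k}, Pi' \in C <-> inv_Wilf_equiv Pi Pi'.

Definition p123 : 'S_3 := perm_of_word 2 [:: 1; 2; 3].
Definition p132 : 'S_3 := perm_of_word 2 [:: 1; 3; 2].
Definition p213 : 'S_3 := perm_of_word 2 [:: 2; 1; 3].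
Definition p231 : 'S_3 := perm_of_word 2 [:: 2; 3; 1].
Definition p312 : 'S_3 := perm_of_word 2 [:: 3; 1; 2].
Definition p321 : 'S_3 := perm_of_word 2 [:: 3; 2; 1].

Definition listed_classes : seq {set {set 'S_3}} :=
  [:: [set [set p123; p132]; [set p123; p213]];
      [set [set p231; p321]; [set p312; p321]];
      [set [set p123; p231]; [set p123; p312]];
      [set [set p132; p321]; [set p213; p321]];
      [set [set p132; p231]; [set p132; p312];
           [set p213; p231]; [set p213; p312]]].

(* Main.v *)
Require Import Defs.
From HB Require Import structures.
From mathcomp Require Import all_boot all_order all_algebra all_fingroup.
(* Makes [inv] the inversion number again, rather than the group inverse. *)
Import Defs.

Set Implicit Arguments.
Unset Strict Implicit.
Unset Printing Implicit Defensive.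

(** Group inverse and reverse-complement (conjugation by the decreasing
    permutation) preserve both the inversion number and pattern containment,
    so they carry a set of patterns to an inv-Wilf equivalent one
    ([inv_Wilf_equiv_symmetry]).  On patterns of length 3, the inverse exchanges
    231 with 312 and reverse-complement exchanges moreover 132 with 213; these
    two symmetries account for every equivalence in the list.

    Conversely, a permutation of length 3 contains only itself among the
    patterns of length 3, so the polynomial for n = 3 is the sum of q^inv over
    the complement of the set of patterns.  It therefore determines how many
    patterns of each inversion number the set has ([inv_Wilf_equiv_profile]).
    As inv takes the values 0, 1, 1, 2, 2, 3 on 123, 132, 213, 231, 312, 321,
    the choices left open by these numbers are exactly those identified by the
    symmetries: for each listed class, and for every other pair, the sets with
    the same numbers are the members of the class. *)

(** * Occurrences of patterns *)

(** With an equivalence on positions too, an occurrence treats positions and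
    values alike, as the symmetry under inverses requires. *)
Lemma containsP n k (s : 'S_n) (p : 'S_k) :
  reflect (exists f : 'I_k -> 'I_n,
             (forall i j, (f i < f j) = (i < j)) /\
             (forall i j, (s (f i) < s (f j)) = (p i < p j)))
          (contains s p).
Proof.
apply: (iffP existsP) => [[f /andP[/'forall_'forall_implyP f_inc
                                    /'forall_'forall_eqP sf]] | [f [f_inc sf]]].
  exists f; split=> // i j; apply/idP/idP; last exact: f_inc.
  case: (ltngtP i j) => [// | /f_inc lt_fji | /val_inj->]; last by rewrite ltnn.
  by rewrite ltnNge ltnW.
exists [ffun i => f i]; apply/andP; split.
  by apply/'forall_'forall_implyP => i j lt_ij; rewrite !ffunE f_inc.
by apply/'forall_'forall_eqP => i j; rewrite !ffunE sf.
Qed.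

Lemma increasing_leq n (f : 'I_n -> 'I_n) :
  (forall i j, (f i < f j) = (i < j)) -> forall i : 'I_n, i <= f i.
Proof.
move=> f_inc [m lt_mn] /=; elim: m lt_mn => // m IHm lt_mn.
have lt_m := ltnW lt_mn.
by apply: leq_ltn_trans (IHm lt_m) _; rewrite f_inc.
Qed.

Lemma ltn_rev_ord n (i j : 'I_n) : (rev_ord i < rev_ord j) = (j < i).
Proof. by rewrite /= ltn_sub2lE. Qed.

Lemma increasing_id n (f : 'I_n -> 'I_n) :
  (forall i j, (f i < f j) = (i < j)) -> f =1 id.
Proof.
move=> f_inc i; apply/val_inj/eqP; rewrite eqn_leq (increasing_leq f_inc) andbT.
(* The upper bound is the lower bound for the map with the order reversed. *)
pose g i := rev_ord (f (rev_ord i)).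
have g_inc a b : (g a < g b) = (a < b) by rewrite ltn_rev_ord f_inc ltn_rev_ord.
by have := increasing_leq g_inc (rev_ord i); rewrite /g rev_ordK leqNgt ltn_rev_ord -leqNgt.
Qed.

Lemma contains_same_length n (s p : 'S_n) : contains s p = (s == p).
Proof.
apply/containsP/eqP => [[f [/increasing_id f_id sf]] | ->]; last by exists id.
have sp_inc i j : (s (p^-1%g i) < s (p^-1%g j)) = (i < j).
  by have := sf (p^-1%g i) (p^-1%g j); rewrite !f_id !permKV.
by apply/permP => i; rewrite -{1}(permK p i) (increasing_id sp_inc (p i)).
Qed.

Lemma Av_same_length n (Pi : {set 'S_n}) : Av n Pi = ~: Pi.
Proof.
apply/setP => s; rewrite !inE; apply/forall_inP/idP => [avs | nPis p Pip].
  by apply/negP => /avs; rewrite /avoids contains_same_length eqxx.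
by rewrite /avoids contains_same_length; apply: contraNneq nPis => ->.
Qed.

(** * Symmetries *)

(** Exchanging positions and values turns an occurrence [f] of [p] in [s] into
    the occurrence at the positions [s (f (p^-1 i))] of the inverse. *)
Lemma contains_invg_imp n k (s : 'S_n) (p : 'S_k) :
  contains s p -> contains s^-1%g p^-1%g.
Proof.
case/containsP => f [f_inc sf]; apply/containsP.
exists (fun i => s (f (p^-1%g i))); split=> i j; first by rewrite sf !permKV.
by rewrite !permK f_inc.
Qed.

Lemma contains_invg n k (s : 'S_n) (p : 'S_k) :
  contains s^-1%g p^-1%g = contains s p.
Proof.
by apply/idP/idP => /contains_invg_imp //; rewrite !invgK.
Qed.

Lemma inv_invg n (s : 'S_n) : inv s^-1%g = inv s.
Proof.
(* An inversion at positions (i, j) of s is one at (s j, s i) of s^-1. *)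
have swap_inj : injective (fun ij : 'I_n * 'I_n => (s ij.2, s ij.1)).
  by move=> [i j] [i' j'] [] /perm_inj-> /perm_inj->.
rewrite /inv -[RHS](card_imset _ swap_inj).
apply: eq_card => -[i j]; rewrite inE /=; apply/idP/imsetP => [ij | ].
  by exists (s^-1%g j, s^-1%g i); rewrite ?inE /= !permKV // andbC.
by case=> -[a b]; rewrite inE /= => ab [-> ->]; rewrite !permK andbC.
Qed.

Definition decreasing n : 'S_n := perm (@rev_ord_inj n).

Definition revcomp n (s : 'S_n) : 'S_n := (decreasing n * s * decreasing n)%g.

Lemma revcompE n (s : 'S_n) i : revcomp s i = rev_ord (s (rev_ord i)).
Proof. by rewrite !permM !permE. Qed.

Lemma revcompK n : involutive (@revcomp n).
Proof. by move=> s; apply/permP => i; rewrite !revcompE !rev_ordK. Qed.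

Lemma contains_revcomp_imp n k (s : 'S_n) (p : 'S_k) :
  contains s p -> contains (revcomp s) (revcomp p).
Proof.
case/containsP => f [f_inc sf]; apply/containsP.
exists (fun i => rev_ord (f (rev_ord i))); split=> i j.
  by rewrite ltn_rev_ord f_inc ltn_rev_ord.
by rewrite !revcompE !rev_ordK !ltn_rev_ord sf.
Qed.

Lemma contains_revcomp n k (s : 'S_n) (p : 'S_k) :
  contains (revcomp s) (revcomp p) = contains s p.
Proof.
by apply/idP/idP => /contains_revcomp_imp //; rewrite !revcompK.
Qed.

Lemma inv_revcomp n (s : 'S_n) : inv (revcomp s) = inv s.
Proof.
have swap_inj : injective (fun ij : 'I_n * 'I_n => (rev_ord ij.2, rev_ord ij.1)).
  by apply: inv_inj => -[i j]; rewrite /= !rev_ordK.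
rewrite /inv -[RHS](card_imset _ swap_inj).
apply: eq_card => -[i j]; rewrite inE [in LHS]/= !revcompE ltn_rev_ord.
apply/idP/imsetP => [ij | ].
  by exists (rev_ord j, rev_ord i); rewrite ?inE ?ltn_rev_ord //= !rev_ordK.
by case=> -[a b]; rewrite inE /= => ab [-> ->]; rewrite !rev_ordK ltn_rev_ord.
Qed.

(** An involution [phi] of permutations of all lengths that respects
    containment maps the avoiders of [phi @: Pi] onto those of [Pi]. *)
Lemma inv_Wilf_equiv_symmetry (phi : forall n, 'S_n -> 'S_n) k (Pi : {set 'S_k}) :
    (forall n, involutive (phi n)) ->
    (forall n (s : 'S_n) (p : 'S_k), contains (phi n s) (phi k p) = contains s p) ->
    (forall n (s : 'S_n), inv (phi n s) = inv s) ->
  inv_Wilf_equiv Pi (phi k @: Pi).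
Proof.
move=> phiK phi_contains phi_inv n; rewrite /invpoly.
rewrite [RHS](reindex_inj (inv_inj (phiK n))).
apply: eq_big => [s | s _]; last by rewrite phi_inv.
rewrite !inE; apply/forall_inP/forall_inP => avs p.
  by case/imsetP=> r Pir ->; rewrite /avoids phi_contains; apply: avs.
by move=> Pip; rewrite /avoids -phi_contains; apply: avs; apply: imset_f.
Qed.

Lemma inv_Wilf_equiv_invg k (Pi : {set 'S_k}) :
  inv_Wilf_equiv Pi [set p^-1%g | p in Pi].
Proof.
pose phi n (s : 'S_n) := (s^-1)%g.
have phiK n : involutive (phi n) by apply: invgK.
have phi_contains n (s : 'S_n) (p : 'S_k) : contains (phi n s) (phi k p) = contains s p.
  exact: contains_invg.
exact: (inv_Wilf_equiv_symmetry Pi phiK phi_contains inv_invg).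
Qed.

Lemma inv_Wilf_equiv_revcomp k (Pi : {set 'S_k}) :
  inv_Wilf_equiv Pi [set revcomp p | p in Pi].
Proof.
exact: (inv_Wilf_equiv_symmetry Pi revcompK (fun n s p => contains_revcomp s p) inv_revcomp).
Qed.

(** * What the polynomial at the length of the patterns determines *)

Lemma invpoly_same_length n (Pi : {set 'S_n}) :
  (invpoly n Pi + \sum_(s in Pi) 'X^(inv s) = \sum_(s : 'S_n) 'X^(inv s))%R.
Proof.
rewrite /invpoly Av_same_length [RHS](bigID (mem Pi)) /= GRing.addrC.
by congr (_ + _)%R; apply: eq_bigl => s; rewrite inE.
Qed.

Lemma inv_Wilf_equiv_card k (Pi Pi' : {set 'S_k}) :
  inv_Wilf_equiv Pi Pi' ->
  forall m, #|[set s in Pi | inv s == m]| = #|[set s in Pi' | inv s == m]|.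
Proof.
move=> /(_ k) eqI m.
have coefE (A : {set 'S_k}) :
    ((\sum_(s in A) 'X^(inv s) : {poly int})`_m = #|[set s in A | inv s == m]|%:Z)%R.
  rewrite coef_sum -sum1_card -natz GRing.natr_sum.
  under [RHS]eq_bigl => s do rewrite inE.
  rewrite big_mkcondr; apply: eq_bigr => s _.
  by rewrite coefXn eq_sym; case: (inv s == m).
have eqS : (\sum_(s in Pi) 'X^(inv s) = \sum_(s in Pi') 'X^(inv s) :> {poly int})%R.
  by apply: (GRing.addrI (invpoly k Pi)); rewrite {2}eqI !invpoly_same_length.
by apply/eqP; rewrite -eqz_nat -!coefE eqS.
Qed.

(** * Patterns of length 3 *)

Lemma perm_of_wordE n (w : seq nat) (i : 'I_n.+1) :
  perm_eq w (iota 1 n.+1) -> perm_of_word n w i = (nth 0 w i).-1 :> nat.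
Proof.
move=> /perm_of_wordK {2}<-.
by rewrite (nth_map ord0) ?size_enum_ord // nth_ord_enum.
Qed.

Lemma perm_of_word_eq n (w w' : seq nat) :
    perm_eq w (iota 1 n.+1) -> perm_eq w' (iota 1 n.+1) ->
  (perm_of_word n w == perm_of_word n w') = (w == w').
Proof.
move=> Hw Hw'; apply/eqP/eqP => [|-> //].
by move/(congr1 (@one_line _)); rewrite !perm_of_wordK.
Qed.

Definition S3 : seq 'S_3 := [:: p123; p132; p213; p231; p312; p321].

Lemma S3_uniq : uniq S3.
Proof. by rewrite /= !inE !perm_of_word_eq. Qed.

Lemma mem_S3 : S3 =i [set: 'S_3].
Proof.
apply/subset_cardP; last by apply/subsetP => s; rewrite inE.
by rewrite (card_uniqP S3_uniq) cardsT card_Sn.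
Qed.

Lemma inv_S3 : [seq inv s | s <- S3] = [:: 0; 1; 1; 2; 2; 3].
Proof.
have invE n (s : 'S_n) : inv s = \sum_(i < n) \sum_(j < n) ((i < j) && (s j < s i)).
  rewrite /inv -sum1_card pair_bigA big_mkcond /=.
  by apply: eq_bigr => ij _; rewrite inE; case: ifP.
by rewrite /= !invE !big_ord_recl !big_ord0 !perm_of_wordE.
Qed.

Lemma eq_S3 (A B : {set 'S_3}) :
  (A == B) = all (fun s => (s \in A) == (s \in B)) S3.
Proof.
apply/eqP/allP => [-> // | eqAB].
by apply/setP => s; apply/eqP/eqAB; rewrite mem_S3 inE.
Qed.

Lemma card_S3 (A : {set 'S_3}) : #|A| = count (mem A) S3.
Proof.
rewrite -size_filter -(card_uniqP (filter_uniq _ S3_uniq)).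
by apply: eq_card => s; rewrite mem_filter mem_S3 in_setT andbT.
Qed.

(** How many elements have 0, 1, 2 and 3 inversions, expanded into memberships
    so that statements on subsets of S_3 reduce to checks on six booleans. *)
Definition profile (A : {set 'S_3}) : nat * nat * nat * nat :=
  (nat_of_bool (p123 \in A), (p132 \in A) + (p213 \in A),
   (p231 \in A) + (p312 \in A), nat_of_bool (p321 \in A)).

Lemma inv_Wilf_equiv_profile (A B : {set 'S_3}) :
  inv_Wilf_equiv A B -> profile A = profile B.
Proof.
move=> /inv_Wilf_equiv_card eqAB.
have cardE (D : {set 'S_3}) m :
    #|[set s in D | inv s == m]| = count (fun s => (s \in D) && (inv s == m)) S3.
  by rewrite card_S3; apply: eq_count => s; rewrite !inE.
case: inv_S3 => i0 i1 i2 i3 i4 i5.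
pose cnt (D : {set 'S_3}) m := #|[set s in D | inv s == m]|.
have profileE D : profile D = (cnt D 0, cnt D 1, cnt D 2, cnt D 3).
  by rewrite /cnt /profile !cardE /= i0 i1 i2 i3 i4 i5; do 6!case: (_ \in D).
by rewrite !profileE /cnt !eqAB.
Qed.

Lemma invg_S3 :
  [seq p^-1%g | p <- S3] = [:: p123; p132; p213; p312; p231; p321].
Proof.
have invgE (p q : 'S_3) : (forall i, q (p i) = i) -> (p^-1)%g = q.
  move=> pK; apply: (mulgI p); rewrite mulgV.
  by apply/permP => i; rewrite perm1 permM pK.
have wordE w w' : (forall i : 'I_3, perm_of_word 2 w' (perm_of_word 2 w i) = i) ->
  ((perm_of_word 2 w)^-1)%g = perm_of_word 2 w' by apply: invgE.
by congr [:: _; _; _; _; _; _]; apply: wordE => i; apply: val_inj;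
   rewrite /= !perm_of_wordE //; case: i => [[|[|[|]]]].
Qed.

Lemma revcomp_S3 :
  [seq revcomp p | p <- S3] = [:: p123; p213; p132; p312; p231; p321].
Proof.
by congr [:: _; _; _; _; _; _]; apply/permP => i; apply: val_inj;
   rewrite revcompE /= !perm_of_wordE //=; case: i => [[|[|[|]]]].
Qed.

Lemma inv_Wilf_equiv_pair_invg k (p q : 'S_k) :
  inv_Wilf_equiv [set p; q] [set p^-1%g; q^-1%g].
Proof. by have := inv_Wilf_equiv_invg [set p; q]; rewrite imsetU1 imset_set1. Qed.

Lemma inv_Wilf_equiv_pair_revcomp k (p q : 'S_k) :
  inv_Wilf_equiv [set p; q] [set revcomp p; revcomp q].
Proof. by have := inv_Wilf_equiv_revcomp [set p; q]; rewrite imsetU1 imset_set1. Qed.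

(** * The classes *)

(** Each of the first four classes is a couple exchanged by one symmetry, and
    the last one is the orbit of {132, 231} under both. *)
Lemma listed_class_equiv (C : {set {set 'S_3}}) :
  C \in listed_classes ->
  exists2 A, A \in C & forall B, B \in C -> inv_Wilf_equiv A B.
Proof.
have equiv_trans (A B D : {set 'S_3}) :
    inv_Wilf_equiv A B -> inv_Wilf_equiv B D -> inv_Wilf_equiv A D.
  by move=> AB BD n; rewrite AB.
case: invg_S3 => i123 i132 i213 i231 i312 i321.
case: revcomp_S3 => r123 r132 r213 r231 r312 r321.
rewrite !inE => /or4P[/eqP-> | /eqP-> | /eqP-> | /orP[] /eqP->].
- exists [set p123; p132]; first by rewrite set21.
  move=> B /set2P[] -> //.
  by have := inv_Wilf_equiv_pair_revcomp p123 p132; rewrite r123 r132.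
- exists [set p231; p321]; first by rewrite set21.
  move=> B /set2P[] -> //.
  by have := inv_Wilf_equiv_pair_invg p231 p321; rewrite i231 i321.
- exists [set p123; p231]; first by rewrite set21.
  move=> B /set2P[] -> //.
  by have := inv_Wilf_equiv_pair_invg p123 p231; rewrite i123 i231.
- exists [set p132; p321]; first by rewrite set21.
  move=> B /set2P[] -> //.
  by have := inv_Wilf_equiv_pair_revcomp p132 p321; rewrite r132 r321.
have inv132 := inv_Wilf_equiv_pair_invg p132 p231.
have rev132 := inv_Wilf_equiv_pair_revcomp p132 p231.
have inv213 := inv_Wilf_equiv_pair_invg p213 p312.
rewrite i132 i231 in inv132; rewrite r132 r231 in rev132; rewrite i213 i312 in inv213.
exists [set p132; p231]; first by rewrite !inE eqxx.
move=> B; rewrite !inE -!orbA => /or4P[] /eqP-> //.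
exact: equiv_trans rev132 inv213.
Qed.

(** The inversion numbers in a listed class are {0, 1}, {2, 3}, {0, 2}, {1, 3}
    and {1, 2} respectively, and the class has every choice of patterns with
    these numbers. *)
Lemma listed_class_profile (C : {set {set 'S_3}}) (A B : {set 'S_3}) :
  C \in listed_classes -> A \in C -> (B \in C) = (profile A == profile B).
Proof.
rewrite !inE => /or4P[/eqP-> | /eqP-> | /eqP-> | /orP[] /eqP->];
rewrite !inE -?orbA; [move/orP | move/orP | move/orP | move/orP | move/or4P];
case=> /eqP->; rewrite !eq_S3 /profile /= !inE !perm_of_word_eq //=;
by do 6!case: (_ \in B).
Qed.

(** The remaining pairs are {123, 321}, {132, 213} and {231, 312}, with inversion
    numbers {0, 3}, {1, 1} and {2, 2}: each contains all the patterns with its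
    inversion numbers. *)
Lemma unlisted_pair_profile (A B : {set 'S_3}) :
    #|A| = 2 -> (forall C : {set {set 'S_3}}, C \in listed_classes -> A \notin C) ->
  profile A = profile B -> B = A.
Proof.
rewrite card_S3 => cardA /allP; rewrite /= !inE => unlisted eq_profile.
apply/eqP; move/eqP: cardA; move/eqP: eq_profile; move: unlisted.
rewrite !eq_S3 /profile /= !inE !perm_of_word_eq //=.
by do 6!case: (_ \in A) => //; do 6!case: (_ \in B).
Qed.

Theorem theorem4p1 :
  (forall C : {set {set 'S_3}}, C \in listed_classes -> inv_Wilf_class C) /\
  (forall (C : {set {set 'S_3}}) (Pi : {set 'S_3}),
     inv_Wilf_class C -> C \notin listed_classes ->
     Pi \in C -> #|Pi| = 2 -> Pi <> [set p123; p321] ->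
     C = [set Pi]).
Proof.
have listedP (C : {set {set 'S_3}}) : C \in listed_classes -> inv_Wilf_class C.
  move=> listedC; have [A CA equivA] := listed_class_equiv listedC.
  exists A => B; split; first exact: equivA.
  by move/inv_Wilf_equiv_profile/eqP; rewrite -(listed_class_profile _ listedC CA).
split=> // C Pi [A classC] unlistedC CPi card_Pi _.
have {A classC} classC B : B \in C <-> inv_Wilf_equiv Pi B.
  have /classC A_Pi := CPi.
  split=> [/classC A_B n | Pi_B]; first by rewrite -A_Pi.
  by apply/classC => n; rewrite A_Pi.
have unlistedPi (D : {set {set 'S_3}}) : D \in listed_classes -> Pi \notin D.
  move=> listedD; apply: contra unlistedC => DPi.
  have [A classD] := listedP D listedD; have /classD A_Pi := DPi.
  suff -> : C = D by [].
  apply/setP => B; apply/idP/idP => [/classC PiB | /classD A_B].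
    by apply/classD => n; rewrite A_Pi.
  by apply/classC => n; rewrite -A_Pi.
apply/setP => B; rewrite inE; apply/idP/eqP => [/classC | -> //].
by move/inv_Wilf_equiv_profile/(unlisted_pair_profile card_Pi unlistedPi).
Qed.
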